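(* Let $(G,\mathcal{U},\varphi)$ be a self-similar ultragraph and let $s=(\alpha,A,g,\omega)$ be an element of $\mathcal{S}_{G,\mathcal{U}}$. Then: (1) For each $\mathcal{F}_{(\omega,\mathcal{B})}\in\mathrm{Z}(\omega,g^{-1}\cdot A)$, we have $\theta_s(\mathcal{F}_{(\omega,\mathcal{B})})=\mathcal{F}_{(\alpha,\,g\cdot\mathcal{B}\downarrow_{s(\alpha)})}$. (2) For each $\mathcal{F}_{(\gamma,\mathcal{B})}\in\mathrm{Z}(\omega,g^{-1}\cdot A)$ with $\gamma\in\mathcal{U}^{\ge1}$, we have $\theta_s(\mathcal{F}_{(\gamma,\mathcal{B})})=\mathcal{F}_{(\alpha(g\cdot\gamma),\,\varphi(g,\gamma)\cdot\mathcal{B})}$.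
   Context: **Ultragraphs.** An ultragraph $\mathcal{U}=(U^0,\mathcal{U}^1,r,s)$ consists of a set $U^0$ of vertices, a set $\mathcal{U}^1$ of edges and maps $r,s:\mathcal{U}^1\to P(U^0)\setminus\{\emptyset\}$ ($P$ = power set) such that $r(e)$ is a singleton for every $e$. Standing assumption: $\mathcal{U}$ is row-finite without sources, i.e. $\{e\in\mathcal{U}^1: r(e)=\{v\}\}$ is nonempty and finite for all $v\in U^0$. $\mathcal{U}^0$ denotes the smallest subset of $P(U^0)$ containing $\emptyset$, all $\{v\}$ ($v\in U^0$), all $s(e)$ ($e\in\mathcal{U}^1$), and closed under finite $\cap,\cup,\setminus$. A path of length $n\ge1$ is a sequence $\alpha=e_1\cdots e_n$ of edges with $r(e_{i+1})\subseteq s(e_i)$; $r(\alpha)=r(e_1)$, $s(\alpha)=s(e_n)$, $|\alpha|=n$; $\mathcal{U}^{\ge1}$ is the set of all such paths. Concatenation $\alpha\beta$ is defined when $r(\beta)\subseteq s(\alpha)$. **Self-similar ultragraph.** A triple $(G,\mathcal{U},\varphi)$ where $\mathcal{U}=(U^0,\mathcal{U}^1,r,s)$ is a row-finite ultragraph without sources, $G$ is a countable discrete group with identity $1_G$ acting on $U^0\sqcup\mathcal{U}^1$ by ultragraph automorphisms (bijections preserving $U^0$ and $\mathcal{U}^1$ with $r(g\cdot e)=g\cdot r(e)$, $s(g\cdot e)=g\cdot s(e)$, where $g\cdot A=\{g\cdot v:v\in A\}$), and $\varphi:G\times\mathcal{U}^1\to G$ satisfies $\varphi(gh,e)=\varphi(g,h\cdot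 e)\varphi(h,e)$ and $\varphi(g,e)\cdot s(e)\subseteq g\cdot s(e)$. Extend to paths inductively by $g\cdot(\alpha_1\alpha_2)=(g\cdot\alpha_1)(\varphi(g,\alpha_1)\cdot\alpha_2)$, $\varphi(g,\alpha_1\alpha_2)=\varphi(\varphi(g,\alpha_1),\alpha_2)$. **The inverse semigroup $\mathcal{S}_{G,\mathcal{U}}$.** Add a universal path $\omega$ of length zero with $\omega\omega=\omega$, $\omega\alpha=\alpha\omega=\alpha$, $s(\omega)=r(\omega)=U^0$, $g\cdot\omega=\omega$, $\varphi(g,\omega)=g$; put $\mathcal{U}^\sharp=\{\omega\}\cup\mathcal{U}^{\ge1}$. Let $\mathcal{S}_{G,\mathcal{U}}=\{(\alpha,A,g,\beta):\alpha,\beta\in\mathcal{U}^\sharp, A\in\mathcal{U}^0, g\in G, \emptyset\ne A\subseteq s(\alpha)\cap g\cdot s(\beta)\}\cup\{0\}$, where $0$ is a zero element, with involution $(\alpha,A,g,\beta)^*=(\beta,g^{-1}\cdot A,g^{-1},\alpha)$, $0^*=0$, and product $(\alpha,A,g,\beta)(\gamma,B,h,\delta)$ equal to - $(\alpha(g\cdot\varepsilon),\ s(g\cdot\varepsilon)\cap(\varphi(g,\varepsilon)\cdot B),\ \varphi(g,\varepsilon)h,\ \delta)$ if $\gamma=\beta\varepsilon$, $\varepsilon\in\mathcal{U}^{\ge1}$, $g\cdot r(\varepsilon)\subseteq A$; - $(\alpha,\ A\cap(g\varphi(h^{-1},\varepsilon)^{-1}\cdot s(h^{-1}\cdot\varepsilon)),\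 g\varphi(h^{-1},\varepsilon)^{-1},\ \delta(h^{-1}\cdot\varepsilon))$ if $\beta=\gamma\varepsilon$, $\varepsilon\in\mathcal{U}^{\ge1}$, $r(\varepsilon)\subseteq B$; - $(\alpha,A\cap(g\cdot B),gh,\delta)$ if $\gamma=\beta$ and $A\cap(g\cdot B)\neq\emptyset$; - $0$ otherwise. This is an inverse semigroup with zero; its nonzero idempotents are $q_{(\alpha,A)}:=(\alpha,A,1_G,\alpha)$ with $\alpha\in\mathcal{U}^\sharp$, $A\in\mathcal{U}^0$, $\emptyset\ne A\subseteq s(\alpha)$. **Tight spectrum and action.** A filter in $\mathcal{E}=\mathcal{E}(\mathcal{S}_{G,\mathcal{U}})$ (the idempotents, ordered by $e\le f\iff ef=e$) is a nonempty subset closed under products and upward closed; $\widehat{\mathcal{E}}_0$ is the set of filters not containing $0$ with the topology generated by the sets $\{\mathcal{F}:e\in\mathcal{F},e_1,\dots,e_n\notin\mathcal{F}\}$; ultrafilters are the maximal filters not containing $0$; $\mathcal{T}$ is the closure of the set of ultrafilters in $\widehat{\mathcal{E}}_0$. Put $\mathrm{Z}(\beta,B)=\{\mathcal{F}\in\mathcal{T}:q_{(\beta,B)}\in\mathcal{F}\}$. For $s\in\mathcal{S}_{G,\mathcal{U}}$, $\theta_s:\{\mathcal{F}\in\mathcal{T}:s^*s\in\mathcal{F}\}\to\{\mathcal{F}\in\mathcal{T}:ss^*\in\mathcal{F}\}$ is $\theta_s(\mathcal{F})=(s\mathcal{F}s^* )\uparrow$ (upward closure in $\mathcal{E}$). **The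 filters $\mathcal{F}_{(\alpha,\mathcal{B})}$.** For $\alpha\in\mathcal{U}^\sharp$ let $\mathcal{B}_{s(\alpha)}=\{A\in\mathcal{U}^0:A\subseteq s(\alpha)\}$ (so $\mathcal{B}_{s(\omega)}=\mathcal{U}^0$). For a filter $\mathcal{B}$ in $(\mathcal{B}_{s(\alpha)},\cap,\subseteq)$ all of whose members are infinite sets, with $\alpha=\alpha_1\cdots\alpha_{|\alpha|}$ written in edges, $$\mathcal{F}_{(\alpha,\mathcal{B})}=\{q_{(\alpha,A)}:A\in\mathcal{B}\}\cup\{q_{(\beta,A)}:|\beta|<|\alpha|,\ \beta=\alpha_1\cdots\alpha_{|\beta|},\ r(\alpha_{|\beta|+1})\subseteq A\}$$ (with $\beta=\omega$ when $|\beta|=0$); $\mathcal{F}_{(\omega,\mathcal{B})}=\{q_{(\omega,A)}:A\in\mathcal{B}\}$. For $g\in G$, $g\cdot\mathcal{B}=\{g\cdot B:B\in\mathcal{B}\}$, and $g\cdot\mathcal{B}\downarrow_{s(\alpha)}=\{(g\cdot B)\cap s(\alpha):B\in\mathcal{B}\}$ (equal to $g\cdot\mathcal{B}$ when $\alpha=\omega$). *)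

(* Defs.v *)
(* MathComp / MathComp-Analysis *)
From HB Require Import structures.
From mathcomp Require Import all_boot.
From mathcomp Require Import boolp classical_sets functions cardinality.
From mathcomp Require Import topology.

Set Implicit Arguments.
Unset Strict Implicit.
Unset Printing Implicit Defensive.

Local Open Scope classical_set_scope.

Record ultragraph := Ultragraph {
  vertex : Type;
  edge : Type;
  rng : edge -> set vertex;
  src : edge -> set vertex;
  rng_singleton : forall e, exists v, rng e = [set v];
  src_neq0 : forall e, src e !=set0;
  no_sources : forall v, [set e | rng e = [set v]] !=set0;
  row_finite : forall v, finite_set [set e | rng e = [set v]]
}.

Section Ultragraph.
Variable U : ultragraph.

Definition set_algebra (D : set (set (vertex U))) : Prop :=
  forall A B, D A -> D B -> [/\ D (A `&` B), D (A `|` B) & D (A `\` B)].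

Definition gen_vertices : set (set (vertex U)) :=
  smallest set_algebra
    ([set set0] `|` range (fun v => [set v]) `|` range (@src U)).

(* The universal path is encoded as the empty sequence, so that it is a
   two-sided unit for concatenation [++], and the set of all [is_path] sequences
   is the set of paths of length >= 1 together with the universal path. *)
Definition is_path (a : seq (edge U)) : Prop :=
  sorted (fun e f => `[< rng f `<=` src e >]) a.

Definition prng (a : seq (edge U)) : set (vertex U) :=
  if a is e :: _ then rng e else setT.

Definition psrc (a : seq (edge U)) : set (vertex U) :=
  if a is e :: a' then src (last e a') else setT.

End Ultragraph.

(* An action of G on the disjoint union of vertices and edges preserving both
   parts is a pair of actions; bijectivity follows from the action laws. *)
Record self_similar (G : groupType) (U : ultragraph) := SelfSimilar {
  vact : G -> vertex U -> vertex U;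
  eact : G -> edge U -> edge U;
  phi : G -> edge U -> G;
  G_countable : countable [set: G];
  vact1 : forall v, vact 1%g v = v;
  vactM : forall g h v, vact (g * h)%g v = vact g (vact h v);
  eact1 : forall e, eact 1%g e = e;
  eactM : forall g h e, eact (g * h)%g e = eact g (eact h e);
  rng_eact : forall g e, rng (eact g e) = vact g @` rng e;
  src_eact : forall g e, src (eact g e) = vact g @` src e;
  phiM : forall g h e, phi (g * h)%g e = (phi g (eact h e) * phi h e)%g;
  phi_src : forall g e, vact (phi g e) @` src e `<=` vact g @` src e
}.

Section SelfSimilar.
Variables (G : groupType) (U : ultragraph) (X : self_similar G U).

Notation V := (vertex U).
Notation path := (seq (edge U)).

Definition sact (g : G) (A : set V) : set V := vact X g @` A.

Fixpoint pact (g : G) (a : path) : path :=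
  if a is e :: a' then eact X g e :: pact (phi X g e) a' else [::].

Fixpoint pphi (g : G) (a : path) : G :=
  if a is e :: a' then pphi (phi X g e) a' else g.

(* [quad] ranges over all formal quadruples; the inverse semigroup is the subset
   [sg_carrier], and only products of its elements are meaningful. *)
Inductive sg : Type :=
| sg0 : sg
| quad : path -> set V -> G -> path -> sg.

Definition sg_carrier : set sg := fun x =>
  match x with
  | sg0 => True
  | quad a A g b =>
      [/\ is_path a, is_path b, gen_vertices A, A !=set0
        & A `<=` psrc a `&` sact g (psrc b)]
  end.

Definition sg_star (x : sg) : sg :=
  match x with
  | sg0 => sg0
  | quad a A g b => quad b (sact g^-1%g A) g^-1%g a
  end.

(* The path eps with c = b eps (resp. b = c eps), if it exists, is
   [drop (size b) c] (resp. [drop (size c) b]). *)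
Definition sg_mul (x y : sg) : sg :=
  match x, y with
  | quad a A g b, quad c B h d =>
      let eps := drop (size b) c in
      let eps' := drop (size c) b in
      if `[< [/\ c = b ++ eps, eps <> [::] & sact g (prng eps) `<=` A] >] then
        quad (a ++ pact g eps)
             (psrc (pact g eps) `&` sact (pphi g eps) B)
             (pphi g eps * h)%g
             d
      else if `[< [/\ b = c ++ eps', eps' <> [::] & prng eps' `<=` B] >] then
        let k := (g * (pphi h^-1 eps')^-1)%g in
        quad a
             (A `&` sact k (psrc (pact h^-1%g eps')))
             k
             (d ++ pact h^-1%g eps')
      else if `[< c = b /\ A `&` sact g B !=set0 >] then
        quad a (A `&` sact g B) (g * h)%g d
      else sg0
  | _, _ => sg0
  end.

Definition idem : set sg := [set e | sg_carrier e /\ sg_mul e e = e].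

Definition idem_le (e f : sg) : Prop := sg_mul e f = e.

Definition upclosure (F : set sg) : set sg :=
  [set f | idem f /\ exists2 e, F e & idem_le e f].

Definition qidem (a : path) (A : set V) : sg := quad a A 1%g a.

Definition idem_filter (F : set sg) : Prop :=
  [/\ F `<=` idem,
      F !=set0,
      forall e f, F e -> F f -> F (sg_mul e f)
    & forall e f, F e -> idem f -> idem_le e f -> F f].

Definition filter_space : Type :=
  {F : set sg | idem_filter F /\ ~ F sg0}.

HB.instance Definition _ := gen_eqMixin filter_space.
HB.instance Definition _ := gen_choiceMixin filter_space.

Definition filter_subbase : set (set filter_space) :=
  [set O | exists (e : sg) (n : nat) (f : 'I_n -> sg),
     [/\ idem e, forall i, idem (f i)
       & O = [set F | sval F e /\ forall i, ~ sval F (f i)]]].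

HB.instance Definition _ :=
  isSubBaseTopological.Build filter_space filter_subbase id.

Definition ultrafilters : set filter_space :=
  [set F | forall F' : filter_space, sval F `<=` sval F' -> F' = F].

Definition tight_filters : set (set sg) :=
  (fun F : filter_space => sval F) @` closure ultrafilters.

Definition cylinder (b : path) (B : set V) : set (set sg) :=
  [set F | tight_filters F /\ F (qidem b B)].

(* The partial map theta_s is given by a total function; its domain is the set
   of tight filters containing s^* s. *)
Definition theta (s : sg) (F : set sg) : set sg :=
  upclosure [set sg_mul (sg_mul s f) (sg_star s) | f in F].

Definition Bsrc (a : path) : set (set V) :=
  [set A | gen_vertices A /\ A `<=` psrc a].

(* The pairs (a, B) for which the filter F_(a, B) is defined. *)
Definition inf_filter (a : path) (B : set (set V)) : Prop :=
  is_path a /\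
  [/\ B `<=` Bsrc a,
      B !=set0,
      forall A C, B A -> B C -> B (A `&` C),
      forall A C, B A -> Bsrc a C -> A `<=` C -> B C
    & forall A, B A -> infinite_set A].

Definition Ffilt (a : path) (B : set (set V)) : set sg :=
  [set qidem a A | A in B] `|`
  [set x | exists b e c A,
     [/\ a = b ++ e :: c, rng e `<=` A, sg_carrier (qidem b A) & x = qidem b A]].

Definition Bact (g : G) (B : set (set V)) : set (set V) :=
  [set sact g A | A in B].

Definition Brestr (B : set (set V)) (a : path) : set (set V) :=
  [set A `&` psrc a | A in B].

End SelfSimilar.

Arguments sg0 {G U}.

(* Main.v *)
Require Import Defs.
From HB Require Import structures.
From mathcomp Require Import all_boot.
From mathcomp Require Import boolp classical_sets functions cardinality.
From mathcomp Require Import topology.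

Set Implicit Arguments.
Unset Strict Implicit.
Unset Printing Implicit Defensive.

Local Open Scope classical_set_scope.

(** Writing [q(b, C)] for the idempotent [qidem b C], let [F] be a filter
    [F_(gamma, B)] and [s = (alpha, A, g, omega)].  Everything rests on two
    facts about idempotents.

    - The order.  Every nonzero idempotent is some [q(a, C)], and
      [q(a, C) <= q(b, D)] holds exactly when either [a = b] and [C] is
      contained in [D], or [b] is a proper prefix of [a] and [D] contains the
      range of the next edge of [a] ([qidem_leP]).  The two cases are the two
      halves of the definition of [F_(a, B)]: that set is the upward closure
      of [{q(a, C) | C in B}], and [C] need only run through a coinitial part of
      [B].  So the upward closure of a set [S] equals [F_(a, B)] as soon as [S]
      lies in [F_(a, B)] and contains [q(a, C)] for a coinitial family of members
      [C] of [B] ([upclosure_Ffilt]).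

    - Conjugation.  [s q(omega, C) s^*] is [q(alpha, A `&` g C)], and for a
      nonempty path [b] whose range [g] carries into [A], [s q(b, C) s^*] is
      [q(alpha (g b), phi(g, b) C)] ([sg_conj_nil], [sg_conj_path]).

    For [gamma = omega], the filter contains [q(omega, g^-1 A)], so [g^-1 A] is
    in [B] and the sets [A `&` g C = g (g^-1 A `&` C)] are coinitial among the
    sets [g C `&` s(alpha)]; this also shows that the latter are infinite.  For
    nonempty [gamma], the same hypothesis says that [g] carries the range of
    [gamma] into [A], hence into [s(alpha)], so [alpha (g gamma)] is a path.
    The conjugates of the [q(gamma, C)] are then all the [q(alpha (g gamma), D)]
    with [D] in [phi(g, gamma) B], while the other elements of the filter are
    conjugated to idempotents [q(b, D)] with [b] a proper prefix of
    [alpha (g gamma)] and [D] containing the range of the next edge. *)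

(** * The action on sets of vertices and on paths *)

Section Actions.
Variables (G : groupType) (U : ultragraph) (X : self_similar G U).
Implicit Types (g h : G) (A B C D : set (vertex U)) (a b c : seq (edge U)).

Lemma sact1 A : sact X 1 A = A.
Proof. by rewrite /sact (eq_imagel (fun v _ => vact1 X v)) image_id. Qed.

Lemma sactM g h A : sact X (g * h) A = sact X g (sact X h A).
Proof. by rewrite /sact image_comp; apply: eq_imagel => v _; exact: vactM. Qed.

Lemma sactK g : cancel (sact X g) (sact X g^-1).
Proof. by move=> A; rewrite -sactM mulVg sact1. Qed.

Lemma sactKV g : cancel (sact X g^-1) (sact X g).
Proof. by move=> A; rewrite -sactM mulgV sact1. Qed.

Lemma sactS g A B : A `<=` B -> sact X g A `<=` sact X g B.
Proof. exact: image_subset. Qed.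

Lemma sact_subV g A B : sact X g A `<=` B <-> A `<=` sact X g^-1 B.
Proof.
split=> AB; first by rewrite -(sactK g A); exact: sactS.
by rewrite -(sactKV g B); exact: sactS.
Qed.

Lemma vact_inj g : injective (vact X g).
Proof.
by move=> u v uv; rewrite -(vact1 X u) -(vact1 X v) -(mulVg g) !vactM uv.
Qed.

Lemma sactI g A B : sact X g (A `&` B) = sact X g A `&` sact X g B.
Proof.
apply/seteqP; split=> [_ [v [Av Bv] <-]|_ [[v Av <-] [u Bu /vact_inj uv]]].
  by split; exists v.
by exists v => //; split=> //; rewrite -uv.
Qed.

Lemma sactU g A B : sact X g (A `|` B) = sact X g A `|` sact X g B.
Proof. exact: image_setU. Qed.

Lemma sactD g A B : sact X g (A `\` B) = sact X g A `\` sact X g B.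
Proof.
apply/seteqP; split=> [_ [v [Av nBv] <-]|_ [[v Av <-] nBv]].
  by split; [exists v | case=> u Bu /vact_inj uv; apply: nBv; rewrite -uv].
by exists v => //; split=> // Bv; apply: nBv; exists v.
Qed.

Lemma sact_neq0 g A : A !=set0 -> sact X g A !=set0.
Proof. by case=> v Av; exists (vact X g v), v. Qed.

Lemma sactT g : sact X g setT = setT.
Proof.
apply/seteqP; split=> // v _.
by exists (vact X g^-1 v); rewrite -?vactM ?mulgV ?vact1.
Qed.

Lemma sact_infinite g A : infinite_set A -> infinite_set (sact X g A).
Proof.
by move=> iA fgA; apply: iA; rewrite -(sactK g A); exact: finite_image.
Qed.

Lemma gen_verticesI A B :
  gen_vertices A -> gen_vertices B -> gen_vertices (A `&` B).
Proof.
move=> gA gB D [Dalg sD].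
by have [] := Dalg _ _ (gA D (conj Dalg sD)) (gB D (conj Dalg sD)).
Qed.

Lemma gen_vertices_src (e : edge U) : gen_vertices (src e).
Proof. by move=> D [_]; apply; right; exists e. Qed.

(** The sets [C] with [g C] in a given set algebra form a set algebra, and [g]
    permutes the generators. *)
Lemma gen_vertices_sact g A : gen_vertices A -> gen_vertices (sact X g A).
Proof.
move=> gA D [Dalg sD]; apply: (gA (fun C => D (sact X g C))); split.
  move=> B C DB DC; rewrite sactI sactU sactD; exact: Dalg.
move=> _ [[->|[v _ <-]]|[e _ <-]]; apply: sD.
- by left; left; rewrite /sact image_set0.
- by left; right; exists (vact X g v) => //; rewrite /sact image_set1.
- by right; exists (eact X g e) => //; rewrite src_eact.
Qed.

Lemma phi1 (e : edge U) : phi X 1 e = 1%g.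
Proof.
have := phiM X 1 1 e; rewrite mulg1 eact1 => phi11.
by apply: (@mulgI G (phi X 1 e)); rewrite -phi11 mulg1.
Qed.

(** The axiom gives only one inclusion.  The other one is the axiom for [g^-1]
    at the edge [g e], moved by [phi g e], which the cocycle identity shows to
    be the inverse of [phi g^-1 (g e)].  This equality makes the action of
    [phi g e] a bijection from the sets below [s(e)] onto those below [s(g e)]. *)
Lemma sact_phi g (e : edge U) : sact X (phi X g e) (src e) = src (eact X g e).
Proof.
rewrite src_eact; apply/seteqP; split; first exact: phi_src.
rewrite -src_eact.
have := @phi_src _ _ X g^-1 (eact X g e).
rewrite -(src_eact X g^-1) -eactM mulVg eact1 => /(@sactS (phi X g e) _ _).
rewrite -/(sact X _ _) -sactM.
have := phiM X g g^-1 (eact X g e).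
by rewrite mulgV phi1 -eactM mulVg eact1 => <-; rewrite sact1.
Qed.

Lemma pact1 a : pact X 1 a = a.
Proof. by elim: a => //= e a IH; rewrite eact1 phi1 IH. Qed.

Lemma pphi1 a : pphi X 1 a = 1%g.
Proof. by elim: a => //= e a IH; rewrite phi1 IH. Qed.

Lemma pact_cat g a b : pact X g (a ++ b) = pact X g a ++ pact X (pphi X g a) b.
Proof. by elim: a g => //= e a IH g; rewrite IH. Qed.

Lemma psrc_pact g a : psrc (pact X g a) = sact X (pphi X g a) (psrc a).
Proof.
elim: a g => [|e [|f a] IH] g; first by rewrite /= sactT.
  by rewrite /= sact_phi.
exact: IH.
Qed.

Lemma prng_pact g a : prng (pact X g a) = sact X g (prng a).
Proof. by case: a => [|e a] /=; rewrite ?sactT ?rng_eact. Qed.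

Lemma psrc_cat a b : b <> [::] -> psrc (a ++ b) = psrc b.
Proof. by case: b => // f b _; case: a => //= e a; rewrite last_cat. Qed.

Lemma is_path_cat a b :
  is_path (a ++ b) <->
  [/\ is_path a, is_path b & prng b `<=` psrc a \/ b = [::]].
Proof.
case: a => [|e a]; first by split=> [|[]//]; split=> //; left.
case: b => [|f b]; first by rewrite cats0; split=> [|[]//]; split=> //; right.
rewrite /is_path /= cat_path /=; split.
  by move=> /and3P[? /asboolP ? ?]; split=> //; left.
by move=> [-> -> [/asboolP ->|]].
Qed.

Lemma is_path_pact g a : is_path a -> is_path (pact X g a).
Proof.
elim: a g => // e a IH g; rewrite -cat1s pact_cat.
move=> /is_path_cat[_ pa ea]; apply/is_path_cat; split=> //; first exact: IH.
case: ea => [ea|->]; [left|by right].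
by rewrite prng_pact psrc_pact; exact: sactS.
Qed.

(** * Idempotents and their order *)

Lemma cat_eq_l a b : a ++ b = a -> b = [::].
Proof. by elim: a => //= e a IH [/IH]. Qed.

Lemma sg_carrier_qidem a A :
  sg_carrier X (qidem G a A) <->
  [/\ is_path a, gen_vertices A, A !=set0 & A `<=` psrc a].
Proof.
by rewrite /= sact1 setIid; split=> [[]|[]].
Qed.

(** The two ways of being below [q(b, B)] come from the last two nonzero cases
    of the product; the first nonzero case would make the first path of the
    product strictly longer than [a]. *)
Lemma qidem_leP a A b B : A !=set0 -> A `<=` psrc a ->
  idem_le X (qidem G a A) (qidem G b B) <->
  (a = b /\ A `<=` B) \/ (exists e c, a = b ++ e :: c /\ rng e `<=` B).
Proof.
move=> A0 Aa; rewrite /idem_le /qidem /= ?invg1 ?mul1g; split.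
  case: asboolP => [[_ + _] [/cat_eq_l]|_]; first by rewrite pact1.
  case: asboolP => [[]|_].
    by case: (drop (size b) a) => [|e c] -> // _ eB _; right; exists e, c.
  by case: asboolP => // -[<- _] [<-]; left; split=> // v [_]; rewrite sact1.
case: asboolP => [[]|_].
  move: (drop _ _) => c -> c0 _ [[ab _]|[e [d [ab _]]]].
    by case: c0; move: ab => /esym/cat_eq_l.
  move: ab => /(congr1 size)/eqP.
  by rewrite !size_cat /= -{1}[size a]addn0 -addnA eqn_add2l addnS.
move=> [[<- AB]|[e [c [ab eB]]]]; last subst a.
  rewrite drop_size cats0; case: asboolP => [[_ []]//|_].
  by case: asboolP; rewrite sact1 ?mul1g (setIidl AB)// => -[].
rewrite drop_size_cat//; case: asboolP => [_|[]//].
rewrite ?mul1g pphi1 pact1 !invg1 sact1 setIidl //.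
by rewrite -(@psrc_cat b).
Qed.

Lemma idem_qidem a A : sg_carrier X (qidem G a A) -> idem X (qidem G a A).
Proof.
move=> aA; split=> //; move: aA => /sg_carrier_qidem[_ _ A0 Aa].
by apply/(qidem_leP _ _ A0 Aa); left; split.
Qed.

(** In the first two cases of the product [x x], one of the two paths of the
    result would be strictly longer than that of [x]; the third case forces
    equal paths and [h * h = h]. *)
Lemma idemP x : idem X x ->
  x = sg0 \/ exists a A, x = qidem G a A /\ sg_carrier X (qidem G a A).
Proof.
case: x => [|a A h b] [cx]; first by left.
move=> hx; right; exists a, A.
suff [ab h1] : a = b /\ h = 1%g by subst b h.
move: hx; rewrite /=.
case: asboolP => [[ab + _]|_].
  by move: ab; move: (drop _ _) => c ab c0 [/cat_eq_l]; case: c c0 ab.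
case: asboolP => [[ba + _]|_].
  move: ba; move: (drop _ _) => c ba c0 [_ _ /cat_eq_l].
  by case: c c0 ba.
case: asboolP => [[-> _]|_ //] [_ hh]; split=> //.
by apply: (@mulgI G h); rewrite mulg1.
Qed.

Lemma qidem_le0 a A : ~ idem_le X (qidem G a A) sg0.
Proof. by []. Qed.

End Actions.

(** * The filters attached to a path and a filter of infinite sets *)

Section Filters.
Variables (G : groupType) (U : ultragraph) (X : self_similar G U).
Implicit Types (g : G) (A C D : set (vertex U)) (B : set (set (vertex U))).
Implicit Types (a b c : seq (edge U)).

Lemma Ffilt_carrier a B x : inf_filter a B -> Ffilt X a B x -> sg_carrier X x.
Proof.
move=> [pa [Ba _ _ _ Binf]] [[A BA <-]|[b [e [c [A [_ _ ? ->]]]]]] //.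
have [gA Aa] := Ba _ BA.
by apply/sg_carrier_qidem; split=> //; apply: infinite_setN0; exact: Binf.
Qed.

(** If [q(b, D)] lies above a member of the second kind, then [b] is still a
    proper prefix of [a]: a prefix of a prefix of [a] is one of [a]. *)
Lemma Ffilt_qidem_le a B x f : inf_filter a B ->
  Ffilt X a B x -> idem X f -> idem_le X x f -> Ffilt X a B f.
Proof.
move=> aB Fx /idemP[->|[b' [C [-> bC]]]].
  by move: Fx => [[A _ <-]|[b [e [c [A [_ _ _ ->]]]]]] /qidem_le0.
have /sg_carrier_qidem[_ gC _ Cb] := bC.
have cx := Ffilt_carrier aB Fx.
move: Fx cx => [[A BA <-]|[b [e [c [A [ab eA _ ->]]]]]]
  /sg_carrier_qidem[_ _ A0 Aa].
  move=> /(qidem_leP X _ _ A0 Aa)[[ab AC]|[e [c [ab eC]]]].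
    subst b'; left; exists C => //.
    by case: aB => _ [_ _ _ up _]; exact: (up A).
  by right; exists b', e, c, C.
move=> /(qidem_leP X _ _ A0 Aa)[[bb AC]|[e' [c' [bb eC]]]].
  by subst b'; right; exists b, e, c, C; split=> //; exact: subset_trans AC.
by right; exists b', e', (c' ++ e :: c), C; split=> //; rewrite ab bb -catA.
Qed.

(** Coinitiality is the form needed for the universal path, where conjugating
    by [(alpha, A, g, omega)] also cuts the sets down to [A]. *)
Lemma upclosure_Ffilt a B (S : set (sg G U)) : inf_filter a B ->
  S `<=` Ffilt X a B ->
  (forall C, B C -> exists2 D, S (qidem G a D) & D `<=` C) ->
  upclosure X S = Ffilt X a B.
Proof.
move=> aB SF Sco; apply/seteqP; split=> [f [idf [x /SF Fx xf]]|f Ff].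
  exact: Ffilt_qidem_le xf.
have cf := Ffilt_carrier aB Ff.
case: Ff cf => [[C BC <-]|[b [e [c [C [ab eC _ ->]]]]]] cf.
  have [D SD DC] := Sco _ BC; split; first exact: idem_qidem.
  exists (qidem G a D) => //.
  have /sg_carrier_qidem[_ _ D0 Da] := Ffilt_carrier aB (SF _ SD).
  by apply/(qidem_leP X _ _ D0 Da); left; split.
have [_ [_ [C' BC'] _ _ _]] := aB.
have [D SD _] := Sco _ BC'; split; first exact: idem_qidem.
exists (qidem G a D) => //.
have /sg_carrier_qidem[_ _ D0 Da] := Ffilt_carrier aB (SF _ SD).
by apply/(qidem_leP X _ _ D0 Da); right; exists e, c.
Qed.

(** * Conjugation by (alpha, A, g, omega) *)

Definition sg_conj (s f : sg G U) := sg_mul X (sg_mul X s f) (sg_star X s).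

Lemma sg_conj_nil a A g C : A `&` sact X g C !=set0 ->
  sg_conj (quad a A g [::]) (qidem G [::] C) = qidem G a (A `&` sact X g C).
Proof.
move=> AC; rewrite /sg_conj /=.
case: asboolP => [[_ []]//|_]; case: asboolP => [[_ []]//|_].
case: asboolP => [_|[]//] /=.
case: asboolP => [[_ []]//|_]; case: asboolP => [[_ []]//|_].
rewrite mulg1 mulgV sactKV -setIA [sact X g C `&` A]setIC setIA setIid.
by case: asboolP => [//|[]].
Qed.

(** The right multiplication by [s^*] falls in the second case of the product:
    its range condition is again [g r(b) <= A], and the group element
    [phi(g, b) phi(g, b)^-1] is trivial. *)
Lemma sg_conj_path a A g b C : b <> [::] -> sact X g (prng b) `<=` A ->
  C `<=` psrc b ->
  sg_conj (quad a A g [::]) (qidem G b C) =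
  qidem G (a ++ pact X g b) (sact X (pphi X g b) C).
Proof.
move=> b0 bA Cb; rewrite /sg_conj /= drop0.
case: asboolP => [_|[]//] /=.
rewrite drop0 cats0.
case: asboolP => [[_ []]//|_].
case: asboolP => [_|[]]; last by split=> //; exact/sact_subV.
rewrite mulg1 invgK mulgV sact1 psrc_pact.
by rewrite -setIA setIC -setIA setIid setIidl //; exact: sactS.
Qed.

Lemma gen_vertices_psrcI a A :
  gen_vertices A -> gen_vertices (A `&` psrc a).
Proof.
case: a => [|e a] gA /=; first by rewrite setIT.
by apply: gen_verticesI => //; exact: gen_vertices_src.
Qed.

(** Since [A] lies below [s(a)], the set [g C `&` s(a)] contains
    [g (C `&` g^-1 A)].  As [g^-1 A] is in [B], this makes [g C `&` s(a)]
    infinite; it also shows that a set [D] above it is [g C' `&` s(a)] for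
    [C' = g^-1 D], which is in [B]. *)
Lemma inf_filter_restr g a A B : is_path a -> A `<=` psrc a ->
  inf_filter [::] B -> B (sact X g^-1 A) ->
  inf_filter a (Brestr (Bact X g B) a).
Proof.
move=> pa Aa [_ [Bgen [C0 BC0] BI up Binf]] BA; split=> //; split.
- move=> _ [_ [C BC <-] <-]; split=> //.
  by apply: gen_vertices_psrcI; apply: gen_vertices_sact; case: (Bgen _ BC).
- by do 2!apply: image_nonempty; exists C0.
- move=> _ _ [_ [C BC <-] <-] [_ [D BD <-] <-].
  exists (sact X g (C `&` D)); first by exists (C `&` D) => //; exact: BI.
  by rewrite sactI setIACA setIid.
- move=> _ D [_ [C BC <-] <-] [gD Da] CD.
  exists D; last exact: setIidl.
  exists (sact X g^-1 D); last exact: sactKV.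
  apply: (up _ _ (BI _ _ BC BA)); first by split=> //; exact: gen_vertices_sact.
  apply/sact_subV; rewrite sactI sactKV; apply: subset_trans CD.
  exact: setIS.
- move=> _ [_ [C BC <-] <-].
  have /(@sact_infinite _ _ X g _) := Binf _ (BI _ _ BC BA).
  by apply: sub_infinite_set; rewrite sactI sactKV; exact: setIS.
Qed.

(** Upward closure rests on the equality [psrc_pact]: because of it, a set [D]
    below [s(g c)] pulls back along [phi(g, c)] to a set below [s(c)]. *)
Lemma inf_filter_pact g a c B : c <> [::] -> is_path a ->
  sact X g (prng c) `<=` psrc a -> inf_filter c B ->
  inf_filter (a ++ pact X g c) (Bact X (pphi X g c) B).
Proof.
move=> c0 pa ca [pc [Bgen [C0 BC0] BI up Binf]].
have gc0 : pact X g c <> [::] by case: (c) c0.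
split.
  apply/is_path_cat; split=> //; first exact: is_path_pact.
  by left; rewrite prng_pact.
split; rewrite /Bsrc /= ?psrc_cat // ?psrc_pact.
- move=> _ [C BC <-]; have [gC Cc] := Bgen _ BC.
  by split; [exact: gen_vertices_sact | exact: sactS].
- by apply: image_nonempty; exists C0.
- move=> _ _ [C BC <-] [D BD <-]; exists (C `&` D); first exact: BI.
  exact: sactI.
- move=> _ D [C BC <-] [gD Dc] CD.
  exists (sact X (pphi X g c)^-1 D); last exact: sactKV.
  apply: (up _ _ BC); last exact/sact_subV.
  split; first exact: gen_vertices_sact.
  by rewrite -(sactK X (pphi X g c) (psrc c)); exact: sactS.
- by move=> _ [C BC <-]; apply: sact_infinite; exact: Binf.
Qed.

Lemma Ffilt_nil B C : Ffilt X [::] B (qidem G [::] C) -> B C.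
Proof. by case=> [[D BD [<-]]|[[|? ?] [e [c [D []]]]]]. Qed.

Lemma Ffilt_cons c B C : c <> [::] -> Ffilt X c B (qidem G [::] C) ->
  prng c `<=` C.
Proof.
move=> c0 [[D BD [] //]|[b [e [d [D [-> eD _ [b0 ->]]]]]]].
by rewrite -b0.
Qed.

Lemma theta_Ffilt_nil a A g B : sg_carrier X (quad a A g [::]) ->
  inf_filter [::] B -> B (sact X g^-1 A) ->
  theta X (quad a A g [::]) (Ffilt X [::] B) =
  Ffilt X a (Brestr (Bact X g B) a).
Proof.
move=> [pa _ gA _ Aa] FB BA.
have {}Aa : A `<=` psrc a by move=> v /Aa[].
have aB := inf_filter_restr pa Aa FB BA.
have [_ [Bgen _ BI _ Binf]] := FB.
have conjE C : B C ->
    sg_conj (quad a A g [::]) (qidem G [::] C) = qidem G a (A `&` sact X g C).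
  move=> BC; apply: sg_conj_nil; rewrite -[A in A `&` _](sactKV X g) -sactI.
  by apply/sact_neq0/infinite_setN0/Binf/BI.
apply: upclosure_Ffilt => // [_ [x + <-]|_ [_ [C BC <-] <-]].
  case=> [[C BC <-]|[[|? ?] [e [c [D []]]]]] //.
  rewrite -/(sg_conj _ _) conjE//; left; exists (A `&` sact X g C) => //.
  exists (sact X g (sact X g^-1 A `&` C)).
    by exists (sact X g^-1 A `&` C) => //; exact: BI.
  by rewrite sactI sactKV setIidl // => v [/Aa].
exists (A `&` sact X g C); last by move=> v [Av gCv]; split=> //; exact: Aa.
by exists (qidem G [::] C); [left; exists C | rewrite -/(sg_conj _ _) conjE].
Qed.

Lemma theta_Ffilt_cons a A g c B : sg_carrier X (quad a A g [::]) ->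
  c <> [::] -> inf_filter c B -> sact X g (prng c) `<=` A ->
  theta X (quad a A g [::]) (Ffilt X c B) =
  Ffilt X (a ++ pact X g c) (Bact X (pphi X g c) B).
Proof.
move=> [pa _ gA A0 Aa] c0 FB cA.
have {}Aa : A `<=` psrc a by move=> v /Aa[].
have FB' := inf_filter_pact c0 pa (subset_trans cA Aa) FB.
have [pcg _] := FB'.
have [_ [Bgen _ _ _ _]] := FB.
have conjE C : B C -> sg_conj (quad a A g [::]) (qidem G c C) =
    qidem G (a ++ pact X g c) (sact X (pphi X g c) C).
  by move=> BC; apply: sg_conj_path => //; case: (Bgen _ BC).
apply: upclosure_Ffilt => // [_ [x + <-]|_ [C BC <-]]; last first.
  exists (sact X (pphi X g c) C) => //.
  exists (qidem G c C); first by left; exists C.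
  by rewrite -/(sg_conj _ _) conjE.
rewrite -/(sg_conj _ _).
case=> [[C BC <-]|[b [e [d [C [cE eC /sg_carrier_qidem[pb gC C0 Cb] ->]]]]]].
  by rewrite conjE//; left; exists (sact X (pphi X g c) C) => //; exists C.
right; exists (a ++ pact X g b), (eact X (pphi X g b) e),
  (pact X (phi X (pphi X g b) e) d).
have acE : a ++ pact X g c = (a ++ pact X g b) ++
    eact X (pphi X g b) e :: pact X (phi X (pphi X g b) e) d.
  by rewrite cE pact_cat /= catA.
have pab : is_path (a ++ pact X g b).
  by move: pcg; rewrite acE => /is_path_cat[].
have geC : rng (eact X (pphi X g b) e) `<=` sact X (pphi X g b) C.
  by rewrite rng_eact; exact: sactS.
have [b0|b0] := pselect (b = [::]).
  (* Here the set is cut down to [A]; it still contains the range of the first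
     edge of [g c], by [cA], and so is nonempty. *)
  subst b; rewrite /= cats0 in acE pab geC *.
  have geA : rng (eact X g e) `<=` A by rewrite rng_eact; move: cA; rewrite cE.
  have geAC : rng (eact X g e) `<=` A `&` sact X g C by rewrite subsetI.
  have AC0 : A `&` sact X g C !=set0.
    have [v ve] := rng_singleton (eact X g e).
    by exists v; apply: geAC; rewrite ve.
  exists (A `&` sact X g C); split=> //; last exact: sg_conj_nil.
  apply/sg_carrier_qidem; split=> //; last by move=> v [/Aa].
  by apply: gen_verticesI => //; exact: gen_vertices_sact.
exists (sact X (pphi X g b) C); split=> //.
  apply/sg_carrier_qidem; split=> //; first exact: gen_vertices_sact.
    exact: sact_neq0.
  rewrite psrc_cat ?psrc_pact; first exact: sactS.
  by case: (b) b0.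
apply: sg_conj_path => //.
by move: cA; rewrite cE; case: (b) b0.
Qed.

End Filters.

Theorem proposition7p2 (G : groupType) (U : ultragraph) (X : self_similar G U)
    (alpha : seq (edge U)) (A : set (vertex U)) (g : G)
    (hs : sg_carrier X (quad alpha A g [::])) :
  (forall B : set (set (vertex U)),
     inf_filter [::] B ->
     cylinder X [::] (sact X g^-1%g A) (Ffilt X [::] B) ->
     inf_filter alpha (Brestr (Bact X g B) alpha) /\
     theta X (quad alpha A g [::]) (Ffilt X [::] B) =
       Ffilt X alpha (Brestr (Bact X g B) alpha)) /\
  (forall (gamma : seq (edge U)) (B : set (set (vertex U))),
     gamma <> [::] ->
     inf_filter gamma B ->
     cylinder X [::] (sact X g^-1%g A) (Ffilt X gamma B) ->
     inf_filter (alpha ++ pact X g gamma) (Bact X (pphi X g gamma) B) /\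
     theta X (quad alpha A g [::]) (Ffilt X gamma B) =
       Ffilt X (alpha ++ pact X g gamma) (Bact X (pphi X g gamma) B)).
Proof.
have [pa _ _ _ Aa] := hs.
have {}Aa : A `<=` psrc alpha by move=> v /Aa[].
split=> [B FB [_ /Ffilt_nil BA]|c B c0 FB [_ /(Ffilt_cons c0)/sact_subV cA]].
  by split; [exact: (inf_filter_restr (A := A)) | exact: theta_Ffilt_nil].
split; last exact: theta_Ffilt_cons.
exact: (inf_filter_pact c0 pa (subset_trans cA Aa) FB).
Qed.
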